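(* Let $X$ be a left pseudocancellative unital magma (LPM), with operations $*$, $\backslash$ and unit $e$. The following statements are equivalent: (i) $X$ is a weakly protomodular object in $\mathsf{LPM}$; (ii) for any $x\in X$, there exist $x_1,\dots,x_n\in X$ such that $$x_1\backslash( x_2 \backslash ( \cdots \backslash (x_n \backslash x) \cdots )) = e.$$
   Context: A left pseudocancellative unital magma (LPM) is a set $X$ with two binary operations $*$ and $\backslash$ and a nullary operation (constant) $e\in X$ satisfying, for all $x,y\in X$, the identities $y = x*(x\backslash y)$ and $x = e*x = x*e$. The category $\mathsf{LPM}$ has LPMs as objects and maps preserving $*$, $\backslash$ and $e$ as morphisms; it is a pointed variety of universal algebras (the zero object is the one-element algebra). In a pointed finitely complete category $\mathcal{C}$, two morphisms $f\colon A\to C$ and $g\colon B\to C$ are jointly extremal-epimorphic if, whenever both factor through a common monomorphism $m\colon M\to C$, then $m$ is an isomorphism (in a variety: $C$ is generated as an algebra by the images of $f$ and $g$). A point over $X$ is a pair $(f\colon A\to X,\ s\colon X\to A)$ with $f\circ s=1_X$. It is strong if $s$ and the kernel $k\colon K\to A$ of $f$ are jointly extremal-epimorphic. An object $X$ is weakly protomodular in $\mathcal{C}$ if every point over $X$ is strong. *)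

(* Defs.v *)
From Stdlib Require Import List FunctionalExtensionality ProofIrrelevance.

Set Implicit Arguments.
Unset Strict Implicit.
Unset Printing Implicit Defensive.

Record Category := {
  Ob :> Type;
  Hom : Ob -> Ob -> Type;
  idm : forall A, Hom A A;
  comp : forall A B C, Hom B C -> Hom A B -> Hom A C;
  comp_idl : forall A B (f : Hom A B), comp (idm B) f = f;
  comp_idr : forall A B (f : Hom A B), comp f (idm A) = f;
  comp_assoc : forall A B C D (h : Hom C D) (g : Hom B C) (f : Hom A B),
    comp h (comp g f) = comp (comp h g) f
}.

Arguments idm {c} A.

Notation "g \oc f" := (comp g f) (at level 40, left associativity).

Definition is_pullback (C : Category) (A B D P : C)
    (f : Hom A D) (g : Hom B D) (p : Hom P A) (q : Hom P B) : Prop :=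
  f \oc p = g \oc q /\
  forall (W : C) (u : Hom W A) (v : Hom W B), f \oc u = g \oc v ->
    exists! h : Hom W P, p \oc h = u /\ q \oc h = v.

(* Finite completeness is expressed by pullbacks together with a terminal
   object, the latter being the zero object. *)
Record PointedFCCategory := {
  cat :> Category;
  zero_ob : cat;
  to_zero : forall A : cat, Hom A zero_ob;
  from_zero : forall A : cat, Hom zero_ob A;
  to_zero_unique : forall (A : cat) (f : Hom A zero_ob), f = to_zero A;
  from_zero_unique : forall (A : cat) (f : Hom zero_ob A), f = from_zero A;
  has_pullbacks : forall (A B D : cat) (f : Hom A D) (g : Hom B D),
    exists (P : cat) (p : Hom P A) (q : Hom P B), is_pullback f g p q
}.

Definition zero_hom (C : PointedFCCategory) (A B : C) : Hom A B :=
  from_zero B \oc to_zero A.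

Definition monomorphism (C : Category) (A B : C) (m : Hom A B) : Prop :=
  forall (W : C) (u v : Hom W A), m \oc u = m \oc v -> u = v.

Definition isomorphism (C : Category) (A B : C) (m : Hom A B) : Prop :=
  exists n : Hom B A, n \oc m = idm A /\ m \oc n = idm B.

Definition jointly_extremal_epimorphic (C : Category) (A B D : C)
    (f : Hom A D) (g : Hom B D) : Prop :=
  forall (M : C) (m : Hom M D), monomorphism m ->
    (exists f' : Hom A M, f = m \oc f') ->
    (exists g' : Hom B M, g = m \oc g') ->
    isomorphism m.

Definition is_kernel (C : PointedFCCategory) (K A B : C)
    (k : Hom K A) (f : Hom A B) : Prop :=
  f \oc k = zero_hom K B /\
  forall (W : C) (u : Hom W A), f \oc u = zero_hom W B ->
    exists! h : Hom W K, k \oc h = u.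

Definition is_point (C : Category) (A X : C) (f : Hom A X) (s : Hom X A) : Prop :=
  f \oc s = idm X.

Definition strong_point (C : PointedFCCategory) (A X : C)
    (f : Hom A X) (s : Hom X A) : Prop :=
  is_point f s /\
  forall (K : C) (k : Hom K A), is_kernel k f ->
    jointly_extremal_epimorphic s k.

Definition weakly_protomodular (C : PointedFCCategory) (X : C) : Prop :=
  forall (A : C) (f : Hom A X) (s : Hom X A), is_point f s -> strong_point f s.

Record LPM := {
  carrier :> Type;
  mul : carrier -> carrier -> carrier;
  ldiv : carrier -> carrier -> carrier;
  unit_el : carrier;
  mul_ldiv : forall x y, y = mul x (ldiv x y);
  mul_1l : forall x, x = mul unit_el x;
  mul_1r : forall x, x = mul x unit_el
}.

Arguments unit_el {l}.

Declare Scope lpm_scope.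
Delimit Scope lpm_scope with lpm.
Notation "x \ y" := (ldiv x y) (at level 40, left associativity) : lpm_scope.

Record LPMHom (A B : LPM) := {
  hom_fun :> A -> B;
  hom_mul : forall x y, hom_fun (mul x y) = mul (hom_fun x) (hom_fun y);
  hom_ldiv : forall x y, hom_fun (ldiv x y) = ldiv (hom_fun x) (hom_fun y);
  hom_unit : hom_fun unit_el = unit_el
}.

Lemma LPMHom_ext (A B : LPM) (f g : LPMHom A B) :
  (forall x, f x = g x) -> f = g.
Proof.
destruct f as [f f1 f2 f3], g as [g g1 g2 g3]; simpl; intro H.
assert (E : f = g) by (apply functional_extensionality; exact H).
subst g; f_equal; apply proof_irrelevance.
Qed.

Definition LPM_id (A : LPM) : LPMHom A A.
Proof. exists (fun x => x); reflexivity. Defined.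

Definition LPM_comp (A B C : LPM) (g : LPMHom B C) (f : LPMHom A B) : LPMHom A C.
Proof.
exists (fun x => g (f x)); intros.
- rewrite !hom_mul; reflexivity.
- rewrite !hom_ldiv; reflexivity.
- rewrite !hom_unit; reflexivity.
Defined.

Definition LPMCat : Category.
Proof.
refine {| Ob := LPM; Hom := LPMHom; idm := LPM_id; comp := LPM_comp |};
  intros; apply LPMHom_ext; reflexivity.
Defined.

Definition LPM_zero : LPM.
Proof.
refine {| carrier := unit; mul := fun _ _ => tt; ldiv := fun _ _ => tt;
          unit_el := tt |};
  intros; repeat match goal with x : unit |- _ => destruct x end; reflexivity.
Defined.

Definition LPM_to_zero (A : LPM) : LPMHom A LPM_zero.
Proof. exists (fun _ => tt); reflexivity. Defined.

Lemma ldiv_unit (A : LPM) (x : A) : ldiv unit_el x = x.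
Proof. rewrite (mul_1l (ldiv unit_el x)); symmetry; apply mul_ldiv. Qed.

Definition LPM_from_zero (A : LPM) : LPMHom LPM_zero A.
Proof.
exists (fun _ => unit_el); intros.
- apply mul_1l.
- symmetry; apply ldiv_unit.
- reflexivity.
Defined.

Section Pullback.
Variables (A B D : LPM) (f : LPMHom A D) (g : LPMHom B D).

Definition pb_carrier : Type := {p : A * B | f (fst p) = g (snd p)}.

Lemma pb_ext (p q : pb_carrier) :
  fst (proj1_sig p) = fst (proj1_sig q) ->
  snd (proj1_sig p) = snd (proj1_sig q) -> p = q.
Proof.
destruct p as [[a b] H], q as [[a' b'] H']; simpl; intros; subst.
f_equal; apply proof_irrelevance.
Qed.

Definition LPM_pullback : LPM.
Proof.
unshelve refine {| carrier := pb_carrier;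
  mul := fun p q => exist _ (mul (fst (proj1_sig p)) (fst (proj1_sig q)),
                             mul (snd (proj1_sig p)) (snd (proj1_sig q))) _;
  ldiv := fun p q => exist _ (ldiv (fst (proj1_sig p)) (fst (proj1_sig q)),
                              ldiv (snd (proj1_sig p)) (snd (proj1_sig q))) _;
  unit_el := exist _ (unit_el, unit_el) _ |}; simpl.
- rewrite !hom_mul, (proj2_sig p), (proj2_sig q); reflexivity.
- rewrite !hom_ldiv, (proj2_sig p), (proj2_sig q); reflexivity.
- rewrite !hom_unit; reflexivity.
- intros; apply pb_ext; simpl; apply mul_ldiv.
- intros; apply pb_ext; simpl; apply mul_1l.
- intros; apply pb_ext; simpl; apply mul_1r.
Defined.

Definition LPM_pb1 : LPMHom LPM_pullback A.
Proof. exists (fun p : LPM_pullback => fst (proj1_sig p)); reflexivity. Defined.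

Definition LPM_pb2 : LPMHom LPM_pullback B.
Proof. exists (fun p : LPM_pullback => snd (proj1_sig p)); reflexivity. Defined.

Definition LPM_pb_pair (W : LPM) (u : LPMHom W A) (v : LPMHom W B)
  (H : forall w, f (u w) = g (v w)) : LPMHom W LPM_pullback.
Proof.
exists (fun w => exist _ (u w, v w) (H w) : LPM_pullback); intros; apply pb_ext; simpl;
  first [apply hom_mul | apply hom_ldiv | apply hom_unit].
Defined.

Lemma LPM_is_pullback :
  is_pullback (C := LPMCat) (P := LPM_pullback) f g LPM_pb1 LPM_pb2.
Proof.
split.
- apply LPMHom_ext; intro p; exact (proj2_sig p).
- intros W u v H.
  assert (H' : forall w, f (u w) = g (v w))
    by (intro w; exact (f_equal (fun h : LPMHom W D => h w) H)).
  exists (LPM_pb_pair H'); split.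
  + split; apply LPMHom_ext; reflexivity.
  + intros h [<- <-]; apply LPMHom_ext; intro w; apply pb_ext; reflexivity.
Qed.

End Pullback.

Definition LPMPointed : PointedFCCategory.
Proof.
refine {| cat := LPMCat; zero_ob := (LPM_zero : LPMCat);
          to_zero := LPM_to_zero; from_zero := LPM_from_zero |}.
- intros A f; apply LPMHom_ext; intro x; destruct (f x); reflexivity.
- intros A f; apply LPMHom_ext; intros []; exact (hom_unit f).
- intros A B D f g; exists (LPM_pullback f g), (LPM_pb1 f g), (LPM_pb2 f g).
  apply LPM_is_pullback.
Defined.

(* [iter_ldiv (x1 :: ... :: xn :: nil) x] is x1 \ (x2 \ (... \ (xn \ x))). *)
Definition iter_ldiv (X : LPM) (xs : list X) (x : X) : X :=
  fold_right (fun a b => (a \ b)%lpm) x xs.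

(* Main.v *)
From Stdlib Require Import List PropExtensionality ProofIrrelevance IndefiniteDescription.
Require Import Defs.

Set Implicit Arguments.
Unset Strict Implicit.
Unset Printing Implicit Defensive.

(** Call [x] reducible if it satisfies (ii). If all elements are reducible and
    [(f, s)] is a point over [X], then for [a] over [x] the element
    [s x1 \ (... \ (s xn \ a))] lies in the kernel, and [a] is recovered from it
    by multiplying on the left by the [s xi]. Conversely, [X] is enlarged to an
    LPM [A] over [X] with one new copy of every irreducible element. The kernel
    of [A -> X] is trivial, so strongness of this point makes the section
    surjective, i.e. there is no irreducible element. What makes [A] an LPM is
    that [z] is reducible as soon as some [x \ z] is. *)

(** The two projections of the kernel pair of [m] agree after [m], hence coincide; evaluate them at
    [(x, y)]. *)
Lemma monomorphism_injective (A B : LPM) (m : LPMHom A B) :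
  monomorphism (C := LPMCat) m -> forall x y, m x = m y -> x = y.
Proof.
intros Hm x y E.
assert (K : LPM_pb1 m m = LPM_pb2 m m).
{ apply (Hm (LPM_pullback m m)), LPMHom_ext; intros [p Hp]; exact Hp. }
exact (f_equal (fun h : LPMHom (LPM_pullback m m) A => h (exist _ (x, y) E)) K).
Qed.

Lemma bijective_isomorphism (A B : LPM) (m : LPMHom A B) :
  (forall x y, m x = m y -> x = y) -> (forall b, exists a, m a = b) ->
  isomorphism (C := LPMCat) m.
Proof.
intros inj surj.
pose (n := fun b => proj1_sig (constructive_indefinite_description _ (surj b))).
assert (mn : forall b, m (n b) = b)
  by (intro b; exact (proj2_sig (constructive_indefinite_description _ (surj b)))).
unshelve eexists (Build_LPMHom (hom_fun := n) _ _ _).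
- intros; apply inj; rewrite hom_mul, !mn; reflexivity.
- intros; apply inj; rewrite hom_ldiv, !mn; reflexivity.
- apply inj; rewrite hom_unit, mn; reflexivity.
- split; apply LPMHom_ext; intro x; simpl; [apply inj |]; apply mn.
Qed.

Lemma isomorphism_surjective (A B : LPM) (m : LPMHom A B) :
  isomorphism (C := LPMCat) m -> forall b, exists a, m a = b.
Proof.
intros [n [_ H]] b; exists ((n : LPMHom B A) b).
exact (f_equal (fun h : LPMHom B B => h b) H).
Qed.

Lemma section_monomorphism (C : Category) (A X : C) (f : Hom A X) (s : Hom X A) :
  is_point f s -> monomorphism s.
Proof.
intros H W u v E.
rewrite <- (comp_idl u), <- (comp_idl v), <- H, <- !comp_assoc, E; reflexivity.
Qed.

(** The fibre of [f] over the unit is an LPM, built as a pullback along the zero object, so its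
    inclusion factors through [k]. *)
Lemma kernel_preimage (K A X : LPM) (k : LPMHom K A) (f : LPMHom A X) :
  is_kernel (C := LPMPointed) k f ->
  forall a, f a = unit_el -> exists c, k c = a.
Proof.
intros [_ U] a Ha.
pose (P := LPM_pullback f (LPM_from_zero X)).
destruct (U P (LPM_pb1 f (LPM_from_zero X))) as [h [Hh _]].
{ apply LPMHom_ext; intros [p Hp]; exact Hp. }
pose (w := exist _ (a, tt) Ha : P).
exists ((h : LPMHom P K) w).
exact (f_equal (fun g : LPMHom P A => g w) Hh).
Qed.

Lemma hom_iter_ldiv (A B : LPM) (f : LPMHom A B) (xs : list A) (x : A) :
  f (iter_ldiv xs x) = iter_ldiv (map f xs) (f x).
Proof.
induction xs as [| y xs IH]; simpl; [reflexivity |].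
rewrite hom_ldiv, IH; reflexivity.
Qed.

(** The image of [m] is closed under [mul], and [b = y * (y \ b)] undoes the divisions one by one,
    outermost first. *)
Lemma image_of_iter_ldiv (M A : LPM) (m : LPMHom M A) (ys : list A) (a : A) :
  (forall y, In y ys -> exists c, m c = y) ->
  (exists c, m c = iter_ldiv ys a) -> exists c, m c = a.
Proof.
induction ys as [| y ys IH]; simpl; intros Hys Ha; [exact Ha |].
apply IH; [intros z Hz; apply Hys; right; exact Hz |].
destruct (Hys y (or_introl eq_refl)) as [c Hc], Ha as [d Hd].
exists (mul c d); rewrite hom_mul, Hc, Hd; symmetry; apply mul_ldiv.
Qed.

Definition reducible (X : LPM) (x : X) : Prop :=
  exists xs : list X, xs <> nil /\ iter_ldiv xs x = unit_el.

Lemma reducible_unit (X : LPM) : reducible (unit_el : X).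
Proof. exists (unit_el :: nil); split; [discriminate | apply ldiv_unit]. Qed.

Lemma reducible_of_ldiv (X : LPM) (x z : X) : reducible (ldiv x z) -> reducible z.
Proof.
(* The last entry of the list divides first. *)
intros [xs [_ H]]; exists (xs ++ x :: nil); split.
- intro E; destruct (app_eq_nil _ _ E); discriminate.
- unfold iter_ldiv; rewrite fold_right_app; exact H.
Qed.

Lemma reducible_weakly_protomodular (X : LPM) :
  (forall x : X, reducible x) -> weakly_protomodular (C := LPMPointed) X.
Proof.
intros HX A f s Hfs; split; [exact Hfs |].
intros K k Hk M m Hm [s' Hs] [k' Hk'].
simpl in A, f, s, K, k, M, m, s', k'.
apply bijective_isomorphism; [exact (monomorphism_injective Hm) |].
intro a; destruct (HX (f a)) as [xs [_ Hxs]].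
apply (@image_of_iter_ldiv M A m (map s xs)).
- intros y Hy; apply in_map_iff in Hy; destruct Hy as [x [<- _]].
  exists (s' x); rewrite Hs; reflexivity.
(* Since [f] sends each [s x] back to [x], the iterated division of [a] lands in the kernel. *)
- assert (E : f (iter_ldiv (map s xs) a) = unit_el).
  { rewrite hom_iter_ldiv, map_map, (map_ext _ (fun x => x)), map_id; [exact Hxs |].
    intro x; exact (f_equal (fun h : LPMHom X X => h x) Hfs). }
  destruct (kernel_preimage Hk E) as [c Hc].
  exists (k' c); rewrite <- Hc, Hk'; reflexivity.
Qed.

Section Doubling.
Variable X : LPM.

(* A pair [(x, P)] is the original [x] when [P] is true and the new copy of [x]
   when [P] is false; the latter exists only for irreducible [x]. Propositional
   flags spare any decision on reducibility. *)
Definition doubling_carrier : Type := {p : X * Prop | reducible (fst p) -> snd p}.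

Lemma doubling_ext (p q : doubling_carrier) :
  fst (proj1_sig p) = fst (proj1_sig q) ->
  (snd (proj1_sig p) <-> snd (proj1_sig q)) -> p = q.
Proof.
destruct p as [[x P] H], q as [[y Q] H']; simpl; intros E EPQ.
apply propositional_extensionality in EPQ; subst.
f_equal; apply proof_irrelevance.
Qed.

(* A product takes the flag of its right factor, except that the unit on the
   right must restore the flag of the left one. *)
Definition doubling : LPM.
Proof.
unshelve refine {| carrier := doubling_carrier;
  mul := fun p q =>
    let xy := mul (fst (proj1_sig p)) (fst (proj1_sig q)) in
    exist _ (xy, reducible xy \/
      (snd (proj1_sig q) /\ (fst (proj1_sig q) = unit_el -> snd (proj1_sig p)))) _;
  ldiv := fun p q =>
    exist _ (ldiv (fst (proj1_sig p)) (fst (proj1_sig q)), snd (proj1_sig q)) _;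
  unit_el := exist _ (unit_el, True) _ |}; simpl.
- intro H; left; exact H.
(* The quotient may inherit the flag of [q]: if it is reducible, so is the element under [q]. *)
- intro H; exact (proj2_sig q (reducible_of_ldiv H)).
- intros _; exact I.
- intros [[x P] HP] [[z Q] HQ]; apply doubling_ext; simpl in *; [apply mul_ldiv |].
  rewrite <- mul_ldiv; split; [| tauto].
  intro q; right; split; [exact q |].
  (* [x \ z = e] forces [z = x] and makes it reducible. *)
  intro E; apply HP.
  assert (Ezx : z = x)
    by (rewrite (mul_ldiv x z), E; symmetry; apply mul_1r).
  rewrite <- Ezx; apply (reducible_of_ldiv (x := x)); rewrite E; apply reducible_unit.
- intros [[x P] HP]; apply doubling_ext; simpl in *; [apply mul_1l |].
  rewrite <- mul_1l; tauto.
- intros [[x P] HP]; apply doubling_ext; simpl in *; [apply mul_1r |].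
  rewrite <- mul_1r; tauto.
Defined.

Definition doubling_proj : LPMHom doubling X.
Proof. exists (fun p : doubling => fst (proj1_sig p)); reflexivity. Defined.

Definition doubling_incl : LPMHom X doubling.
Proof.
exists (fun x => exist (fun p : X * Prop => reducible (fst p) -> snd p)
                   (x, True) (fun _ => I) : doubling);
  intros; apply doubling_ext; simpl; tauto.
Defined.

(** The unit is reducible, so it has no second copy. *)
Lemma doubling_proj_unit (a : doubling) : doubling_proj a = unit_el -> a = unit_el.
Proof.
destruct a as [[x P] HP]; simpl; intro E; apply doubling_ext; simpl in *; [exact E |].
split; [tauto | intros _; apply HP; rewrite E; apply reducible_unit].
Qed.

Lemma doubling_kernel :
  is_kernel (C := LPMPointed) (LPM_from_zero doubling) doubling_proj.
Proof.
split; [apply LPMHom_ext; reflexivity |].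
intros W u Hu; exists (LPM_to_zero W); split.
- apply LPMHom_ext; intro w; simpl; symmetry; apply doubling_proj_unit.
  exact (f_equal (fun h : LPMHom W X => h w) Hu).
- intros h _; symmetry; apply (to_zero_unique (p := LPMPointed)).
Qed.

Lemma weakly_protomodular_reducible :
  weakly_protomodular (C := LPMPointed) X -> forall x : X, reducible x.
Proof.
intros HX x.
assert (Hp : is_point (C := LPMPointed) doubling_proj doubling_incl)
  by (apply LPMHom_ext; reflexivity).
destruct (HX doubling doubling_proj doubling_incl Hp) as [_ HK].
assert (Hiso : isomorphism (C := LPMCat) doubling_incl).
(* The section and the zero kernel both factor through the section itself, which is monic. *)
{ apply (HK _ _ doubling_kernel X doubling_incl).
  - exact (section_monomorphism Hp).
  - exists (LPM_id X); apply LPMHom_ext; reflexivity.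
  - exists (LPM_from_zero X); apply LPMHom_ext; reflexivity. }
(* With the flag [reducible x], lying in the image of the section amounts to
   [True = reducible x]. *)
destruct (isomorphism_surjective Hiso
  (exist (fun p : X * Prop => reducible (fst p) -> snd p)
    (x, reducible x) (fun H => H))) as [y Hy].
apply (f_equal (fun p : doubling => snd (proj1_sig p))) in Hy; simpl in Hy.
rewrite <- Hy; exact I.
Qed.

End Doubling.

Theorem theorem2p6 (X : LPM) :
  weakly_protomodular (C := LPMPointed) X <->
  (forall x : X, exists xs : list X, xs <> nil /\ iter_ldiv xs x = unit_el).
Proof.
split.
- exact (@weakly_protomodular_reducible X).
- exact (@reducible_weakly_protomodular X).
Qed.
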